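(* Let $0<q<1$, let $n\in\mathbb N$ (positive integer) and let $c$ be a real number. Let $\widetilde h_n(x;q)$ be the discrete $q$-Hermite II polynomial of degree $n$. Then $$\int\frac{1}{(-x^2;q^2)_\infty}\big(qx[n-1]_q+c[n]_q\big)\widetilde h_n(x;q)\,d_qx=\frac{1-q}{(-x^2;q^2)_\infty}\Big(\widetilde h_n(x;q)-q^{1-n}[n]_q(c+x)\widetilde h_{n-1}(x;q)\Big),$$ $$\int\frac{(-q^{n+3}x^2;q^2)_\infty}{(-x^2;q^2)_\infty}\widetilde h_n(x;q)\,d_qx=\frac{(-q^{n+1}x^2;q^2)_\infty}{[n+1]_q(-x^2;q^2)_\infty}\Big(q^nx\,\widetilde h_n(x;q)-q^{1-n}(1-q^n)\widetilde h_{n-1}(x;q)\Big),$$ and, for $n\ge2$, $$\int\frac{x}{(-x^2;q^2)_\infty}\widetilde h_n(x;q)\,d_qx=\frac{1-q}{[n-1]_q(-x^2;q^2)_\infty}\Big(\frac1q\widetilde h_n(x;q)-q^{-n}[n]_q\,x\,\widetilde h_{n-1}(x;q)\Big),$$ $$\int\frac{x^{n-2}}{(-x^2;q^2)_\infty}\widetilde h_n(x;q)\,d_qx=\frac{x^n}{[n-1]_q(-x^2;q^2)_\infty}\Big(\frac{\widetilde h_n(x;q)}{x}-\widetilde h_{n-1}(x;q)\Big).$$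
   Context: $[n]_q=\frac{1-q^n}{1-q}$; $(a;q)_k=\prod_{j=0}^{k-1}(1-aq^j)$, $(a;q)_\infty=\prod_{j\ge0}(1-aq^j)$. For $x\ne0$, $D_qF(x)=\frac{F(x)-F(qx)}{(1-q)x}$; the indefinite $q$-integral $\int f(x)\,d_qx=F(x)$ means $D_qF(x)=f(x)$. The discrete $q$-Hermite II polynomials are, for $n\in\{0,1,2,\dots\}$, $$\widetilde h_n(x;q)=x^n\,{}_2\phi_1(q^{-n},q^{-n+1};0;q^2,-q^2/x^2)=x^n\sum_{k\ge0}\frac{(q^{-n};q^2)_k(q^{-n+1};q^2)_k}{(q^2;q^2)_k}\Big(\frac{-q^2}{x^2}\Big)^k,$$ a (terminating sum) polynomial in $x$. *)

(* Defs.v *)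
From mathcomp Require Import all_boot all_order all_algebra.
From mathcomp Require Import all_classical all_reals all_analysis.

Set Implicit Arguments.
Unset Strict Implicit.
Unset Printing Implicit Defensive.

Import Order.TTheory GRing.Theory Num.Theory.
Import numFieldNormedType.Exports.

Local Open Scope ring_scope.

Definition qnum (R : realType) (q : R) (n : nat) : R := (1 - q ^+ n) / (1 - q).

Definition qpoch (R : realType) (a q : R) (k : nat) : R :=
  \prod_(0 <= j < k) (1 - a * q ^+ j).

(* The limit exists whenever `|q| < 1. *)
Definition qpoch_infty (R : realType) (a q : R) : R := limn (qpoch a q).

Definition phi21 (R : realType) (a b c q z : R) : R :=
  limn (series (fun k : nat =>
    qpoch a q k * qpoch b q k / (qpoch q q k * qpoch c q k) * z ^+ k)).

(* The series terminates: its k-th term vanishes as soon as n < 2 * k.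
   The formula is the one for x != 0; because x / 0 = 0 in MathComp, at x = 0
   it need not agree with the polynomial that it defines elsewhere. *)
Definition dqhermite2 (R : realType) (n : nat) (x q : R) : R :=
  x ^+ n * phi21 (q ^ (- n%:Z)) (q ^ (- n%:Z + 1)) 0 (q ^+ 2)
                 (- q ^+ 2 / x ^+ 2).

Definition Dq (R : realType) (q : R) (F : R -> R) (x : R) : R :=
  (F x - F (q * x)) / ((1 - q) * x).

(* F is an indefinite q-integral of f. *)
Definition is_qint (R : realType) (q : R) (f F : R -> R) : Prop :=
  forall x : R, x != 0 -> Dq q F x = f x.

(* Main.v *)
Require Import Defs.
From mathcomp Require Import all_boot all_order all_algebra.
From mathcomp Require Import all_classical all_reals all_analysis.
From mathcomp Require Import ring.

Import Order.TTheory GRing.Theory Num.Theory.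
Import numFieldNormedType.Exports.

Local Open Scope ring_scope.

(** Comparing coefficients gives a lowering and a raising relation
    [h_(m+1)(x) - h_(m+1)(qx) = q^-m (1 - q^(m+1)) x h_m(qx)] and
    [h_m(x) - (1 + x^2) h_m(qx) = - q^m x h_(m+1)(x)],
    which express both [h_m(qx)] and [h_(m+1)(qx)] through [h_m(x)] and
    [h_(m+1)(x)].  The weight satisfies
    [(-x^2; q^2)_oo = (1 + x^2) (-q^2 x^2; q^2)_oo], so after clearing it each
    [q]-integral is a rational identity in [x], [q], [q^m], [h_m(x)] and
    [h_(m+1)(x)]. *)

Lemma qpoch0 (R : realType) (a q : R) : qpoch a q 0 = 1.
Proof. by rewrite /qpoch big_nil. Qed.

Lemma qpochS (R : realType) (a q : R) k :
  qpoch a q k.+1 = qpoch a q k * (1 - a * q ^+ k).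
Proof. by rewrite /qpoch big_nat_recr. Qed.

Lemma qpochSl (R : realType) (a q : R) k :
  qpoch a q k.+1 = (1 - a) * qpoch (a * q) q k.
Proof.
rewrite /qpoch big_nat_recl//= expr0 mulr1; congr (_ * _).
by apply: eq_bigr => i _; rewrite exprS mulrA.
Qed.

Lemma qpoch_eq0 (R : realType) (a q : R) j k :
  a * q ^+ j = 1 -> (j < k)%N -> qpoch a q k = 0.
Proof.
move=> aqj; elim: k => // k IH; rewrite ltnS leq_eqVlt qpochS.
by case/predU1P => [<-|/IH->]; rewrite ?aqj ?subrr ?mulr0 ?mul0r.
Qed.

Lemma qpoch_neq0 (R : realType) (q : R) k :
  0 <= q -> q < 1 -> qpoch q q k != 0.
Proof.
move=> q0 q1; elim: k => [|k IH]; first by rewrite qpoch0 oner_eq0.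
by rewrite qpochS mulf_neq0// -exprS subr_eq0 eq_sym lt_eqF// exprn_ilt1.
Qed.

(** Every factor [1 + y * q ^+ j] is at least 1, so the partial products are nondecreasing;
    [1 + t <= expR t] and the geometric series bound them by [expR (y / (1 - q))]. *)
Lemma cvgn_qpochN (R : realType) (y q : R) :
  0 <= y -> 0 <= q -> q < 1 -> cvgn (qpoch (- y) q).
Proof.
move=> y0 q0 q1.
have pge0 k : 0 <= qpoch (- y) q k.
  by apply: prodr_ge0 => j _; rewrite mulNr opprK addr_ge0// mulr_ge0// exprn_ge0.
apply: nondecreasing_is_cvgn.
  apply/nondecreasing_seqP => k; rewrite qpochS mulNr opprK ler_peMr//.
  by rewrite lerDl mulr_ge0// exprn_ge0.
exists (expR (y / (1 - q))) => _ [k _ <-].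
(* The sharper exponent is [y] times the partial geometric sum, which makes the bound inductive in
   [k]. *)
suff: qpoch (- y) q k <= expR (y * ((1 - q ^+ k) / (1 - q))).
  move/le_trans; apply; rewrite ler_expR ler_wpM2l// ler_pdivrMr ?subr_gt0//.
  by rewrite mulVf ?subr_eq0 1?eq_sym ?lt_eqF// lerBlDr lerDl exprn_ge0.
elim: k => [|k IH]; first by rewrite qpoch0 expr0 subrr mul0r mulr0 expR0.
have -> : y * ((1 - q ^+ k.+1) / (1 - q))
        = y * ((1 - q ^+ k) / (1 - q)) + y * q ^+ k.
  by rewrite exprS; field; rewrite subr_eq0 eq_sym lt_eqF.
rewrite expRD qpochS ler_pM//; rewrite mulNr opprK ?expR_ge1Dx//.
by rewrite addr_ge0// mulr_ge0// exprn_ge0.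
Qed.

Lemma qpoch_inftyNE (R : realType) (y q : R) : 0 <= y -> 0 <= q -> q < 1 ->
  qpoch_infty (- y) q = (1 + y) * qpoch_infty (- (y * q)) q.
Proof.
move=> y0 q0 q1; apply/cvg_lim => //; rewrite -(cvg_shiftS _).
have -> : [sequence qpoch (- y) q n.+1]_n
        = (fun k => (1 + y) * qpoch (- (y * q)) q k).
  by apply/funext => k /=; rewrite qpochSl opprK mulNr.
by apply: cvgMl_tmp; apply: cvgn_qpochN => //; rewrite mulr_ge0.
Qed.

Lemma lim_series_finite (R : realType) (u : nat -> R) N :
  (forall k, (N <= k)%N -> u k = 0) ->
  limn (series u) = \sum_(0 <= k < N) u k.
Proof.
move=> u0; apply: (@lim_near_cst R^o) => //; exists N => //= k /= Nk.
rewrite /series/= (big_cat_nat (leq0n N) Nk)/= -[RHS]addr0; congr (_ + _).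
by rewrite big_nat_cond big1// => i /andP[/andP[/u0]].
Qed.

(** The sum stops because one upper symbol acquires a zero factor at index [n./2]: the first symbol
    for even [n], the second for odd [n]. The length [N] is left free so that sums of different
    degrees can be compared termwise. *)
Lemma dqhermite2E (R : realType) (q x : R) n N : q != 0 -> (n < N)%N ->
  dqhermite2 n x q = x ^+ n * \sum_(0 <= k < N)
    qpoch (q ^- n) (q ^+ 2) k * qpoch (q ^- n * q) (q ^+ 2) k
    / qpoch (q ^+ 2) (q ^+ 2) k * (- q ^+ 2 / x ^+ 2) ^+ k.
Proof.
move=> q0 nN; rewrite /dqhermite2 /phi21 expfzDr// expr1z -exprnN.
rewrite (@lim_series_finite _ _ N) => [|k Nk].
  congr (_ * _); apply: eq_bigr => k _; congr (_ / _ * _).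
  by rewrite [X in _ * X]big1 ?mulr1// => j _; rewrite mul0r subr0.
have nk : (n./2 < k)%N.
  by rewrite (leq_ltn_trans _ (leq_trans nN Nk))// -divn2 leq_div.
have qn0 : q ^+ n != 0 by rewrite expf_neq0.
have [on|en] := boolP (odd n).
  rewrite [X in _ * X / _](@qpoch_eq0 _ _ _ n./2) ?mulr0 ?mul0r//.
  rewrite -exprM -mulrA -exprS.
  suff -> : (2 * n./2).+1 = n by rewrite mulVf.
  by rewrite mul2n -[RHS](odd_double_half n) on.
rewrite (@qpoch_eq0 _ _ _ n./2) ?mul0r// -exprM.
suff -> : (2 * n./2)%N = n by rewrite mulVf.
by rewrite mul2n -[RHS](odd_double_half n) (negbTE en).
Qed.

(* With [a = q ^- m], replacing [m] by [m + 1] turns [(a; q^2)_k (aq; q^2)_k] into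
   [(a/q; q^2)_k (a; q^2)_k]; this trades [(a/q; q^2)_k] for [(aq; q^2)_k]. *)
Lemma qpoch_shift (R : realType) (a q : R) k : q != 0 ->
  qpoch (a / q) (q ^+ 2) k * (1 - a / q * (q ^+ 2) ^+ k)
  = (1 - a / q) * qpoch (a * q) (q ^+ 2) k.
Proof.
move=> q0; rewrite -qpochS qpochSl; congr (_ * qpoch _ _ _).
by field.
Qed.

(** The relation holds termwise: passing from [x] to [q * x] divides the [k]-th power of the series
    argument by [(q ^+ 2) ^+ k], and [qpoch_shift] reconciles the symbols of degrees [m.+1] and
    [m]. *)
Lemma dqhermite2_lower (R : realType) (q x : R) m :
  0 < q -> q < 1 -> x != 0 ->
  dqhermite2 m.+1 x q - dqhermite2 m.+1 (q * x) q
  = q ^- m * (1 - q ^+ m.+1) * x * dqhermite2 m (q * x) q.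
Proof.
move=> q_gt0 q_lt1 x0; have q0 : q != 0 by rewrite gt_eqF.
rewrite !(@dqhermite2E _ _ _ _ m.+2)// !mulr_sumr -sumrB.
apply: eq_bigr => k _.
have -> : q ^- m.+1 = q ^- m / q by rewrite exprS invfM mulrC.
have -> : - q ^+ 2 / (q * x) ^+ 2 = (- q ^+ 2 / x ^+ 2) / q ^+ 2.
  by field; rewrite q0 x0.
have := @qpoch_shift _ (q ^- m) q k q0.
have : qpoch (q ^+ 2) (q ^+ 2) k != 0.
  by rewrite qpoch_neq0 ?exprn_ge0 ?exprn_ilt1// ltW.
have : q ^+ m != 0 by rewrite expf_neq0.
have : (q ^+ 2) ^+ k != 0 by rewrite !expf_neq0.
rewrite mulfVK// [(_ / q ^+ 2) ^+ k]expr_div_n.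
rewrite 2!(exprMn _ q x) (exprS x) !(exprS q m).
move: ((- _ / _) ^+ k) ((q ^+ 2) ^+ k) (q ^+ m) (x ^+ m).
move=> z w p y w0 p0.
move: (qpoch _ _ k) (qpoch _ _ k) (qpoch _ _ k) (qpoch _ _ k).
move=> A B C D D0 E.
(* Here [A], [B], [C], [D] are the symbols with first parameters [q ^- m], [q ^- m * q],
   [q ^- m / q], [q ^+ 2]. This is [qpoch_shift] cleared of denominators; the difference of the two
   sides of the goal is a multiple of it. *)
have {}E : C * (q * p - w) = (q * p - 1) * B.
  move: E => /(congr1 (fun t => q * p * t)).
  have -> : q * p * (C * (1 - p^-1 / q * w)) = C * (q * p - w).
    by field; rewrite q0 p0.
  by move=> ->; field; rewrite q0 p0.
apply/eqP; rewrite -subr_eq0; apply/eqP.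
transitivity (A * x * y * z / D / w * (C * (w - q * p) - (1 - q * p) * B)).
  by field; rewrite w0 p0 D0.
have -> : C * (w - q * p) = - (C * (q * p - w)) by ring.
by rewrite E; ring.
Qed.

(** Matching powers of [x] shifts the index: term [k.+1] of the part multiplied by [x ^+ 2] and of
    the right-hand side goes with term [k] of the rest. *)
Lemma dqhermite2_raise (R : realType) (q x : R) m :
  0 < q -> q < 1 -> x != 0 ->
  dqhermite2 m x q - (1 + x ^+ 2) * dqhermite2 m (q * x) q
  = - (q ^+ m * x * dqhermite2 m.+1 x q).
Proof.
move=> q_gt0 q_lt1 x0; have q0 : q != 0 by rewrite gt_eqF.
rewrite mulrDl mul1r opprD addrA (@dqhermite2E _ _ x m m.+2)//.
rewrite [X in _ - X - _](@dqhermite2E _ _ (q * x) m m.+2)//.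
(* The shifted sums are taken one term longer, so that all four have the same range once the terms
   of index 0 are split off. *)
rewrite [X in _ ^+ 2 * X](@dqhermite2E _ _ (q * x) m m.+3) ?ltnS ?leqW//.
rewrite (@dqhermite2E _ _ x m.+1 m.+3)//.
rewrite !(big_nat_recl m.+2)//= !qpoch0 !expr0 !(mulr1, invr1).
rewrite exprMn (exprS x m) !mulrDr !mulr1 !mulrA !mulr_sumr.
apply/eqP; rewrite -subr_eq0 !opprD !opprK; apply/eqP.
set S0 := \sum_(0 <= i < _) _; set S1 := \sum_(0 <= i < _) _.
set S2 := \sum_(0 <= i < _) _; set S3 := \sum_(0 <= i < _) _.
(* The two terms of index 0 cancel each other. *)
transitivity (S0 - S1 - S2 + S3); first by ring.
rewrite {}/S0 {}/S1 {}/S2 {}/S3 -!sumrB -big_split/= big1// => k _.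
have -> : q ^- m.+1 = q ^- m / q by rewrite exprS invfM mulrC.
(* Thanks to the index shift, removing the first factor of this symbol leaves exactly the second
   symbol of degree [m], of length [k]. *)
rewrite mulfVK// [qpoch (_ / q) _ k.+1]qpochSl.
have -> : q ^- m / q * q ^+ 2 = q ^- m * q by field; rewrite q0 expf_neq0.
have -> : - q ^+ 2 / (q * x) ^+ 2 = (- q ^+ 2 / x ^+ 2) / q ^+ 2.
  by field; rewrite q0 x0.
have : qpoch (q ^+ 2) (q ^+ 2) k.+1 != 0.
  by rewrite qpoch_neq0 ?exprn_ge0 ?exprn_ilt1// ltW.
rewrite !qpochS mulf_eq0 => /norP[D0 w1].
have w0 : (q ^+ 2) ^+ k != 0 by rewrite !expf_neq0.
have p0 : q ^+ m != 0 by rewrite expf_neq0.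
rewrite !(exprSr (_ / _)) [(_ / q ^+ 2) ^+ k]expr_div_n.
move: w0 p0 w1.
move: ((- _ / _) ^+ k) ((q ^+ 2) ^+ k) (q ^+ m) (x ^+ m).
move=> z w p y w0 p0 w1.
move: D0; move: (qpoch _ _ k) (qpoch _ _ k) (qpoch _ _ k) => D A B D0.
by field; rewrite x0 D0 w0 p0 q0 w1.
Qed.

Theorem theorem2p4 (R : realType) (q : R) (n : nat) (c : R)
    (q_gt0 : 0 < q) (q_lt1 : q < 1) (n_gt0 : (0 < n)%N) :
  is_qint q
    (fun x => 1 / qpoch_infty (- x ^+ 2) (q ^+ 2)
              * (q * x * qnum q (n - 1) + c * qnum q n) * dqhermite2 n x q)
    (fun x => (1 - q) / qpoch_infty (- x ^+ 2) (q ^+ 2)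
              * (dqhermite2 n x q
                 - q ^ (1 - n%:Z) * qnum q n * (c + x)
                   * dqhermite2 (n - 1) x q))
  /\
  is_qint q
    (fun x => qpoch_infty (- q ^+ (n + 3) * x ^+ 2) (q ^+ 2)
              / qpoch_infty (- x ^+ 2) (q ^+ 2) * dqhermite2 n x q)
    (fun x => qpoch_infty (- q ^+ (n + 1) * x ^+ 2) (q ^+ 2)
              / (qnum q (n + 1) * qpoch_infty (- x ^+ 2) (q ^+ 2))
              * (q ^+ n * x * dqhermite2 n x q
                 - q ^ (1 - n%:Z) * (1 - q ^+ n) * dqhermite2 (n - 1) x q))
  /\
  ((2 <= n)%N ->
   is_qint q
     (fun x => x / qpoch_infty (- x ^+ 2) (q ^+ 2) * dqhermite2 n x q)
     (fun x => (1 - q) / (qnum q (n - 1) * qpoch_infty (- x ^+ 2) (q ^+ 2))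
               * (1 / q * dqhermite2 n x q
                  - q ^ (- n%:Z) * qnum q n * x * dqhermite2 (n - 1) x q))
   /\
   is_qint q
     (fun x => x ^+ (n - 2) / qpoch_infty (- x ^+ 2) (q ^+ 2)
               * dqhermite2 n x q)
     (fun x => x ^+ n / (qnum q (n - 1) * qpoch_infty (- x ^+ 2) (q ^+ 2))
               * (dqhermite2 n x q / x - dqhermite2 (n - 1) x q))).
Proof.
have q0 : q != 0 by rewrite gt_eqF.
have q1 : 1 - q != 0 by rewrite subr_eq0 gt_eqF.
have qX1 k : (0 < k)%N -> 1 - q ^+ k != 0.
  by move=> k0; rewrite subr_eq0 gt_eqF// exprn_ilt1// ?ltW// -lt0n.
have Q0 : 0 <= q ^+ 2 by rewrite sqr_ge0.
have Q1 : q ^+ 2 < 1 by rewrite exprn_ilt1// ltW.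
have x1 (x : R) : 1 + x ^+ 2 != 0 by rewrite gt_eqF// ltr_pwDl// sqr_ge0.
(* The junk value [0^-1 = 0] makes this hold without knowing that the product
   does not vanish. *)
have weightq (x : R) : (qpoch_infty (- (q * x) ^+ 2) (q ^+ 2))^-1
    = (1 + x ^+ 2) / qpoch_infty (- x ^+ 2) (q ^+ 2).
  rewrite [qpoch_infty (- x ^+ 2) _]qpoch_inftyNE ?sqr_ge0//.
  by rewrite invfM mulrA mulfV ?mul1r// exprMn mulrC.
case: n n_gt0 => // m _; rewrite subSS subn0.
have -> : q ^ (1 - m.+1%:Z) = q ^- m.
  by rewrite exprnN; congr (_ ^ _); rewrite -add1n PoszD opprD addrA subrr add0r.
have p0 : q ^+ m != 0 by rewrite expf_neq0.
have hq (x : R) : x != 0 -> dqhermite2 m (q * x) q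
    = (dqhermite2 m x q + q ^+ m * x * dqhermite2 m.+1 x q) / (1 + x ^+ 2).
  move=> x0; apply: (mulIf (x1 x)); rewrite mulfVK// mulrC.
  have := @dqhermite2_raise _ q x m q_gt0 q_lt1 x0.
  by move=> /eqP; rewrite subr_eq => /eqP ->; ring.
have hSq (x : R) : x != 0 -> dqhermite2 m.+1 (q * x) q
    = dqhermite2 m.+1 x q
      - q ^- m * (1 - q ^+ m.+1) * x * dqhermite2 m (q * x) q.
  by move=> x0; rewrite -dqhermite2_lower//; ring.
have qm1' : 1 - q ^+ m.+1 != 0 by rewrite qX1.
have qm2 : 1 - q ^+ m.+2 != 0 by rewrite qX1.
(* The integrals are treated in the order third, fourth, second, first. The assumption [2 <= n]
   makes [[n-1]_q], that is [[m]_q], nonzero. *)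
split; last split; last first.
- move=> m1; have qm1 : 1 - q ^+ m != 0 by rewrite qX1.
  split=> x x0; rewrite /Dq.
    move: (x1 x) (weightq x) (hq x x0) (hSq x x0).
    move: (qpoch_infty (- (q * x) ^+ 2) _) (qpoch_infty (- x ^+ 2) _).
    move: (dqhermite2 m x q) (dqhermite2 m.+1 x q).
    move: (dqhermite2 m (q * x) q) (dqhermite2 m.+1 (q * x) q).
    move=> a' b' a b V W x10 EV Ea Eb.
    rewrite /qnum !invfM EV Eb Ea -exprnN !exprS in qm1' *.
    (* The reciprocal weight is now a common linear factor of both sides and can be treated as an
       arbitrary real. *)
    move: W^-1 => {EV}W.
    move: (q ^+ m) p0 qm1 qm1' => p p0 qm1 qm1'.
    by field; rewrite ?x0 ?q0 ?p0 ?q1 ?qm1 ?x10.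
  move: (x1 x) (weightq x) (hq x x0) (hSq x x0).
  move: (qpoch_infty (- (q * x) ^+ 2) _) (qpoch_infty (- x ^+ 2) _).
  move: (dqhermite2 m x q) (dqhermite2 m.+1 x q).
  move: (dqhermite2 m (q * x) q) (dqhermite2 m.+1 (q * x) q).
  move=> a' b' a b V W x10 EV Ea Eb.
  (* Writing [m] as a successor removes the truncated subtraction in [x ^+ (n - 2)]. *)
  case: m m1 qm1 qm1' p0 Ea Eb {hq hSq qm2} => // m _ qm1 qm1' p0 Ea Eb.
  rewrite /qnum !invfM EV Eb Ea subSS subn1 [m.+1.-1]/=.
  rewrite exprMn !(exprS x) !(exprS q) in p0 qm1 qm1' Ea Eb *.
  move: W^-1 => {EV}W.
  move: p0; rewrite mulf_eq0 => /norP[_ p0].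
  move: (q ^+ m) (x ^+ m) p0 qm1 qm1' => p y p0 qm1 qm1' {Ea Eb}.
  by field; rewrite ?x0 ?q0 ?p0 ?q1 ?qm1 ?x10.
- move=> x x0; rewrite /Dq.
  (* The numerator of the primitive at [q * x] is that of the integrand at [x]; at [x] it has one
     more factor, [1 + q ^+ m.+2 * x ^+ 2]. All three thus share the product [S]. *)
  have -> : - q ^+ (m.+1 + 3) * x ^+ 2 = - (q ^+ m.+2 * x ^+ 2 * q ^+ 2).
    by rewrite addn3 !exprS; ring.
  have -> : - q ^+ (m.+1 + 1) * (q * x) ^+ 2 = - (q ^+ m.+2 * x ^+ 2 * q ^+ 2).
    by rewrite addn1; ring.
  have -> : - q ^+ (m.+1 + 1) * x ^+ 2 = - (q ^+ m.+2 * x ^+ 2).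
    by rewrite addn1 mulNr.
  rewrite [qpoch_infty (- (_ * x ^+ 2)) _]qpoch_inftyNE//; last first.
    by rewrite mulr_ge0 ?sqr_ge0// exprn_ge0// ltW.
  move: (qpoch_infty (- (_ * x ^+ 2 * _)) _) => S.
  move: (x1 x) (weightq x) (hq x x0) (hSq x x0).
  move: (qpoch_infty (- (q * x) ^+ 2) _) (qpoch_infty (- x ^+ 2) _).
  move: (dqhermite2 m x q) (dqhermite2 m.+1 x q).
  move: (dqhermite2 m (q * x) q) (dqhermite2 m.+1 (q * x) q).
  move=> a' b' a b V W x10 EV Ea Eb.
  rewrite /qnum !invfM EV Eb Ea addn1.
  rewrite !exprS in qm2 *.
  move: W^-1 => {EV}W.
  move: (q ^+ m) p0 qm2 {qm1' Ea Eb} => p p0 qm2.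
  by field; rewrite ?x0 ?q0 ?p0 ?q1 ?qm2 ?x10.
- move=> x x0; rewrite /Dq.
  move: (x1 x) (weightq x) (hq x x0) (hSq x x0).
  move: (qpoch_infty (- (q * x) ^+ 2) _) (qpoch_infty (- x ^+ 2) _).
  move: (dqhermite2 m x q) (dqhermite2 m.+1 x q).
  move: (dqhermite2 m (q * x) q) (dqhermite2 m.+1 (q * x) q).
  move=> a' b' a b V W x10 EV Ea Eb.
  rewrite /qnum !invfM EV Eb Ea exprS.
  move: W^-1 => {EV}W.
  move: (q ^+ m) p0 {qm1' qm2 Ea Eb} => p p0.
  by field; rewrite ?x0 ?q0 ?p0 ?q1 ?x10.
Qed.
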